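(* The class of frames of any (intermediate) subframe logic is closed under taking substructures. In particular, subframe logics are canonical.
   Context: An intermediate logic is a set of propositional formulas containing intuitionistic propositional calculus and closed under modus ponens and substitution. A Kripke frame is $(W,R)$ with $W\neq\emptyset$ and $R$ a partial order. A general frame is $(W,R,\mathcal P)$ with $(W,R)$ a Kripke frame and $\mathcal P$ a set of upsets containing $\emptyset,W$, closed under $\cup,\cap$ and $U_0\to U_1:=\{w\mid \forall v\,(wRv\text{ and }v\in U_0\text{ imply }v\in U_1)\}$. It is refined if $\neg wRv$ implies there is $U\in\mathcal P$ with $w\in U$, $v\notin U$; it is compact if every $\mathcal X\subseteq\mathcal P\cup\{W\setminus U\mid U\in\mathcal P\}$ with the finite intersection property has $\bigcap\mathcal X\ne\emptyset$; it is descriptive if it is refined and compact. A Kripke frame is regarded as a general frame with $\mathcal P$ the set of all upsets. A model is a (Kripke or descriptive) frame with a valuation $V$ such that $V(p)\in\mathcal P$ for each variable $p$, with standard intuitionistic Kripke semantics; $\mathfrak F\models\varphi$ means $\varphi$ is true at all worlds of all models on $\mathfrak F$. A frame of $L$ (an $L$-frame) is a (Kripke or descriptive) frame validating all formulas of $L$. A Kripke frame $(W',R')$ is a subframe of a Kripke frame $(W,R)$ iff $W'\subseteq W$ and $R'=R\upharpoonright W'$. A descriptive frame $(W',R',\mathcal P')$ is a subframe of a descriptive frame $(W,R,\mathcal P)$ iff $W'\subseteq W$, $R'=R\upharpoonright W'$ and the topo-subframe condition holds: for all $U\subseteq W'$, $W'\setminus U\in\mathcal P'$ implies $W\setminus R^{-1}(U)\in\mathcal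 P$, where $R^{-1}(U)=\{w\in W\mid wRu\text{ for some }u\in U\}$. A subframe logic is an intermediate logic whose class of (Kripke or descriptive) frames is closed under subframes. A (Kripke or descriptive) frame $\mathfrak G=(W',R',\mathcal P')$ is a substructure of a (Kripke or descriptive) frame $\mathfrak F=(W,R,\mathcal P)$ iff $W'\subseteq W$ and $R'=R\upharpoonright W'$ (no relation between $\mathcal P'$ and $\mathcal P$ is required). A logic $L$ is canonical if the underlying Kripke frame of the canonical model of $L$ is an $L$-frame (vacuous if $L$ is inconsistent); the canonical model has as worlds the consistent $L$-theories with the disjunction property, ordered by inclusion, with $p$ true at $\Gamma$ iff $p\in\Gamma$. *)

(* Defs.v *)
From mathcomp Require Import all_boot.
From mathcomp Require Import boolp classical_sets functions cardinality.

Set Implicit Arguments.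
Unset Strict Implicit.
Unset Printing Implicit Defensive.

Local Open Scope classical_set_scope.

Inductive form : Type :=
| Var of nat
| Bot
| And of form & form
| Or of form & form
| Imp of form & form.

Fixpoint fsubst (s : nat -> form) (f : form) : form :=
  match f with
  | Var p => s p
  | Bot => Bot
  | And f g => And (fsubst s f) (fsubst s g)
  | Or f g => Or (fsubst s f) (fsubst s g)
  | Imp f g => Imp (fsubst s f) (fsubst s g)
  end.

(** Theorems of intuitionistic propositional calculus, Hilbert style. *)
Inductive IPC : set form :=
| IPC_K f g : IPC (Imp f (Imp g f))
| IPC_S f g h : IPC (Imp (Imp f (Imp g h)) (Imp (Imp f g) (Imp f h)))
| IPC_andI f g : IPC (Imp f (Imp g (And f g)))
| IPC_andEl f g : IPC (Imp (And f g) f)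
| IPC_andEr f g : IPC (Imp (And f g) g)
| IPC_orIl f g : IPC (Imp f (Or f g))
| IPC_orIr f g : IPC (Imp g (Or f g))
| IPC_orE f g h : IPC (Imp (Imp f h) (Imp (Imp g h) (Imp (Or f g) h)))
| IPC_botE f : IPC (Imp Bot f)
| IPC_MP f g : IPC (Imp f g) -> IPC f -> IPC g.

Definition closed_MP (X : set form) : Prop :=
  forall f g, X (Imp f g) -> X f -> X g.

Definition closed_subst (X : set form) : Prop :=
  forall s f, X f -> X (fsubst s f).

(** The inconsistent logic is included. *)
Definition intermediate_logic (L : set form) : Prop :=
  [/\ IPC `<=` L, closed_MP L & closed_subst L].

Record kripke_frame (W : Type) : Type := KripkeFrame {
  kle : W -> W -> Prop;
  worlds_inhabited : inhabited W;
  kle_refl : forall w, kle w w;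
  kle_trans : forall u v w, kle u v -> kle v w -> kle u w;
  kle_antisym : forall v w, kle v w -> kle w v -> v = w
}.

Definition upset W (K : kripke_frame W) (U : set W) : Prop :=
  forall w v, kle K w v -> U w -> U v.

Definition upset_imp W (K : kripke_frame W) (U0 U1 : set W) : set W :=
  [set w | forall v, kle K w v -> U0 v -> U1 v].

Record general_frame (W : Type) : Type := GeneralFrame {
  kripke_of :> kripke_frame W;
  adm : set (set W);
  adm_upset : forall U, adm U -> upset kripke_of U;
  adm0 : adm set0;
  admT : adm setT;
  admU : forall U V, adm U -> adm V -> adm (U `|` V);
  admI : forall U V, adm U -> adm V -> adm (U `&` V);
  adm_imp : forall U V, adm U -> adm V -> adm (upset_imp kripke_of U V)
}.

Definition refined W (F : general_frame W) : Prop :=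
  forall w v, ~ kle F w v -> exists U, [/\ adm F U, U w & ~ U v].

Definition finite_intersection_property W (X : set (set W)) : Prop :=
  forall Y : set (set W), finite_set Y -> Y `<=` X ->
    \bigcap_(U in Y) U !=set0.

Definition compact_frame W (F : general_frame W) : Prop :=
  forall X : set (set W),
    X `<=` adm F `|` [set ~` U | U in adm F] ->
    finite_intersection_property X ->
    \bigcap_(U in X) U !=set0.

Definition descriptive W (F : general_frame W) : Prop :=
  refined F /\ compact_frame F.

(** A Kripke frame, seen as a general frame, is one in which every upset is
    admissible. *)
Definition kripke W (F : general_frame W) : Prop :=
  forall U, upset F U -> adm F U.

Definition kripke_or_descriptive W (F : general_frame W) : Prop :=
  kripke F \/ descriptive F.

Section KripkeAsGeneral.
Variables (W : Type) (K : kripke_frame W).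

Fact upset0 : upset K set0. Proof. by []. Qed.
Fact upsetT : upset K setT. Proof. by []. Qed.

Fact upsetU U V : upset K U -> upset K V -> upset K (U `|` V).
Proof.
by move=> uU uV w v wv [Uw|Vw]; [left; apply: uU Uw|right; apply: uV Vw].
Qed.

Fact upsetI U V : upset K U -> upset K V -> upset K (U `&` V).
Proof. by move=> uU uV w v wv [Uw Vw]; split; [apply: uU Uw|apply: uV Vw]. Qed.

Fact upset_upset_imp U V : upset K U -> upset K V -> upset K (upset_imp K U V).
Proof. by move=> _ _ w v wv h x vx; apply: h; apply: kle_trans vx. Qed.

Definition general_of_kripke : general_frame W :=
  @GeneralFrame W K (upset K) (fun U uU => uU)
    upset0 upsetT upsetU upsetI upset_upset_imp.

End KripkeAsGeneral.

Fixpoint forces W (K : kripke_frame W) (V : nat -> set W) (w : W) (f : form)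
    : Prop :=
  match f with
  | Var p => V p w
  | Bot => False
  | And f g => forces K V w f /\ forces K V w g
  | Or f g => forces K V w f \/ forces K V w g
  | Imp f g => forall v, kle K w v -> forces K V v f -> forces K V v g
  end.

Definition valid W (F : general_frame W) (f : form) : Prop :=
  forall V : nat -> set W, (forall p, adm F (V p)) -> forall w, forces F V w f.

Definition L_frame (L : set form) W (F : general_frame W) : Prop :=
  kripke_or_descriptive F /\ forall f, L f -> valid F f.

(** A frame whose set of worlds is a subset [A] of [W] is a frame on the type
    associated with [A]; the inclusion of [A] in [W] is [\val]. *)
Definition restricts_kle W (F : general_frame W) (A : set W)
    (G : general_frame A) : Prop :=
  forall x y : A, kle G x y <-> kle F (\val x) (\val y).

Definition kle_preimage W (K : kripke_frame W) (U : set W) : set W :=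
  [set w | exists2 u, U u & kle K w u].

Definition topo_subframe_condition W (F : general_frame W) (A : set W)
    (G : general_frame A) : Prop :=
  forall U : set A, adm G (~` U) ->
    adm F (~` kle_preimage F [set \val u | u in U]).

Definition subframe W (F : general_frame W) (A : set W) (G : general_frame A)
    : Prop :=
  [/\ kripke F, kripke G & restricts_kle F G] \/
  [/\ descriptive F, descriptive G, restricts_kle F G
    & topo_subframe_condition F G].

Definition substructure W (F : general_frame W) (A : set W)
    (G : general_frame A) : Prop :=
  [/\ kripke_or_descriptive F, kripke_or_descriptive G & restricts_kle F G].

Definition subframe_logic (L : set form) : Prop :=
  intermediate_logic L /\
  forall (W : Type) (F : general_frame W) (A : set W) (G : general_frame A),
    L_frame L F -> subframe F G -> L_frame L G.

Definition L_theory (L X : set form) : Prop := L `<=` X /\ closed_MP X.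

Definition disjunction_property (X : set form) : Prop :=
  forall f g, X (Or f g) -> X f \/ X g.

Definition canonical_worlds (L : set form) : set (set form) :=
  [set X | [/\ L_theory L X, ~ X Bot & disjunction_property X]].

Section CanonicalFrame.
Variable L : set form.

Definition canonical_kle (X Y : canonical_worlds L) : Prop :=
  \val X `<=` \val Y.

Fact canonical_kle_refl X : canonical_kle X X.
Proof. exact: subset_refl. Qed.

Fact canonical_kle_trans X Y Z :
  canonical_kle X Y -> canonical_kle Y Z -> canonical_kle X Z.
Proof. exact: subset_trans. Qed.

Fact canonical_kle_antisym X Y : canonical_kle X Y -> canonical_kle Y X -> X = Y.
Proof. by move=> XY YX; apply: val_inj; apply/seteqP. Qed.

Definition canonical_kripke_frame (ne : inhabited (canonical_worlds L)) :
    kripke_frame (canonical_worlds L) :=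
  KripkeFrame ne canonical_kle_refl canonical_kle_trans canonical_kle_antisym.

End CanonicalFrame.

(** The witness [ne] always exists for a consistent [L] (Lindenbaum); it is
    needed only because the worlds of a Kripke frame form a nonempty type. *)
Definition canonical_logic (L : set form) : Prop :=
  ~ L Bot ->
  exists ne : inhabited (canonical_worlds L),
    L_frame L (general_of_kripke (canonical_kripke_frame ne)).

(* Main.v *)
Require Import Defs.
From mathcomp Require Import all_boot.
From mathcomp Require Import boolp classical_sets functions cardinality.

(** The point is that a descriptive frame [F] of a subframe logic [L] has an
    underlying Kripke frame that is again an [L]-frame.  If an arbitrary upset
    valuation refutes [phi] at [x], then finitely many worlds, closed under
    witnesses for the refuted implications of [phi], already refute it: a proper
    witness forces strictly more subformulas, so the search terminates.  Around
    each selected world [a] there is a clopen cell, cut out by the finitely many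
    admissible sets separating the selected worlds, and shrunk so that each of
    its points sees the cells of the witnesses of [a].  The union of the cells is
    clopen, hence carries a topo-subframe of [F], and on it an admissible
    valuation makes every point of the cell of [a] agree with [a] on the
    subformulas of [phi]; so [phi] is not in [L].  Canonicity follows since the
    canonical frame, with the sets of worlds containing a given formula as
    admissible sets, is a descriptive [L]-frame. *)

Set Implicit Arguments.
Unset Strict Implicit.
Unset Printing Implicit Defensive.

Local Open Scope classical_set_scope.

Lemma finite_set_ind T (P : set T -> Prop) :
  P set0 -> (forall x D, P D -> P (x |` D)) -> forall D, finite_set D -> P D.
Proof.
elim/Pchoice: T => T in P *.
move=> P0 PU D /finite_seqP[s ->]; elim: s => [|x s IHs].
  by rewrite classical_sets.set_nil.
have -> : [set` x :: s] = x |` [set` s]; last exact: PU.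
apply/seteqP; split=> y /=; rewrite in_cons.
  by move=> /orP[/eqP|]; [left|right].
by move=> [->|ys]; rewrite ?eqxx ?ys ?orbT.
Qed.

(** * Clopen sets of a general frame *)

Section Clopen.
Variables (W : Type) (F : general_frame W).

(** This is the Boolean algebra generated by [adm F], in disjunctive normal form, so that proofs
    about it reduce to one difference and to binary unions. *)
Inductive clopen : set (set W) :=
| clopen0 : clopen set0
| clopen_diff U V of adm F U & adm F V : clopen (U `\` V)
| clopenU C D of clopen C & clopen D : clopen (C `|` D).

Lemma clopen_adm U : adm F U -> clopen U.
Proof. by move=> aU; rewrite -(setD0 U); apply: clopen_diff => //; apply: adm0. Qed.

Lemma clopenC_adm U : adm F U -> clopen (~` U).
Proof. by move=> aU; rewrite -setTD; apply: clopen_diff => //; apply: admT. Qed.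

Lemma clopenI C D : clopen C -> clopen D -> clopen (C `&` D).
Proof.
elim=> {C} [|U V aU aV|C C' _ IHC _ IHC'] cD.
- by rewrite set0I; apply: clopen0.
- elim: cD => {D} [|U' V' aU' aV'|D D' _ IHD _ IHD'].
  + by rewrite setI0; apply: clopen0.
  + have -> : (U `\` V) `&` (U' `\` V') = (U `&` U') `\` (V `|` V').
      by rewrite !setDE setCU setIACA.
    by apply: clopen_diff; [apply: admI|apply: admU].
  + by rewrite setIUr; apply: clopenU.
- by rewrite setIUl; apply: clopenU; [apply: IHC|apply: IHC'].
Qed.

Lemma clopen_bigcap I (D : set I) (C : I -> set W) :
  finite_set D -> (forall i, D i -> clopen (C i)) -> clopen (\bigcap_(i in D) C i).
Proof.
move=> fD; elim/finite_set_ind: D / fD => [_|i D IHD cC].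
  by rewrite bigcap_set0; apply/clopen_adm/admT.
rewrite bigcap_setU1; apply: clopenI; first by apply: cC; left.
by apply: IHD => j Dj; apply: cC; right.
Qed.

Lemma clopen_bigcup I (D : set I) (C : I -> set W) :
  finite_set D -> (forall i, D i -> clopen (C i)) -> clopen (\bigcup_(i in D) C i).
Proof.
move=> fD; elim/finite_set_ind: D / fD => [_|i D IHD cC].
  by rewrite bigcup_set0; apply: clopen0.
rewrite bigcup_setU1; apply: clopenU; first by apply: cC; left.
by apply: IHD => j Dj; apply: cC; right.
Qed.

(** Preimages distribute over unions, and the complement of the preimage of a difference is a
    Heyting implication. This is the only source of new admissible sets below. *)
Lemma adm_setC_preimage C : clopen C -> adm F (~` kle_preimage F C).
Proof.
elim=> {C} [|U V aU aV|C D _ IHC _ IHD].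
- have -> : ~` kle_preimage F set0 = setT by apply/seteqP; split=> // w _ [].
  exact: admT.
- have -> : ~` kle_preimage F (U `\` V) = upset_imp F U V; last exact: adm_imp.
  apply/seteqP; split=> w /= h.
    by move=> v wv Uv; apply: contrapT => nVv; apply: h; exists v.
  by move=> [v [Uv nVv] wv]; apply/nVv/h.
- have -> : ~` kle_preimage F (C `|` D) =
      ~` kle_preimage F C `&` ~` kle_preimage F D.
    apply/seteqP; split=> w /= => [h|[hC hD] [v [Cv|Dv] wv]].
    + by split=> -[v hv wv]; apply: h; exists v => //; [left|right].
    + by apply: hC; exists v.
    + by apply: hD; exists v.
  exact: admI.
Qed.

Lemma clopen_preimage C : clopen C -> clopen (kle_preimage F C).
Proof.
by move=> cC; rewrite -(setCK (kle_preimage F C)); apply/clopenC_adm/adm_setC_preimage.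
Qed.

Lemma clopen_compact C (X : set (set W)) :
    compact_frame F -> clopen C -> X `<=` adm F `|` [set ~` U | U in adm F] ->
    (forall Y : set (set W), finite_set Y -> Y `<=` X ->
       C `&` \bigcap_(U in Y) U !=set0) ->
  C `&` \bigcap_(U in X) U !=set0.
Proof.
move=> cF cC; elim: cC X => {C} [|U V aU aV|C D _ IHC _ IHD] X XF hX.
- by have [w []] := hX set0 (finite_set0 _) (sub0set _).
(* A difference is imposed by adding its two halves to the family. *)
- pose X' := X `|` [set U; ~` V].
  have [||w wX'] := cF X'.
  + move=> Z [/XF//|[->|->]]; first by left.
    by right; exists V.
  + move=> Y fY YX'.
    have [||w [[Uw nVw] wY]] := hX (Y `&` X); [|by move=> ? []|].
      by apply: finite_setI; left.
    exists w => Z YZ; have [XZ|[->|->]] := YX' Z YZ => //.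
    exact: wY.
  + exists w; split=> [|Z XZ]; last by apply: wX'; left.
    by split; [apply: (wX' U)|apply: (wX' (~` V))]; right; [left|right].
- have [hC|] := pselect (forall Y : set (set W), finite_set Y -> Y `<=` X ->
    C `&` \bigcap_(U in Y) U !=set0).
    by have [w [Cw wX]] := IHC X XF hC; exists w; split=> //; left.
  (* [Y0] has no common point in [C]; joined to any finite [Y], it forces the common point in the
     union to lie in [D]. *)
  move=> /existsNP[Y0 /not_implyP[fY0 /not_implyP[Y0X nY0]]].
  have [Y fY YX|w [Dw wX]] := IHD X XF; last by exists w; split=> //; right.
  have [||w [CDw wY]] := hX (Y0 `|` Y).
  + by rewrite finite_setU.
  + by rewrite subUset.
  + case: CDw => [Cw|Dw].
      by case: nY0; exists w; split=> // Z Y0Z; apply: wY; left.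
    by exists w; split=> // Z YZ; apply: wY; right.
Qed.

End Clopen.

(** * Clopen sets carry descriptive topo-subframes *)

Section ClopenSubframe.
Variables (W : Type) (F : general_frame W) (C : set W).
Hypotheses (cC : clopen F C) (C0 : C !=set0).

Let Cval (x : C) : C (\val x).
Proof. exact: set_valP. Qed.

Let inC w (Cw : C w) : C := exist _ w (mem_set Cw).

Let sub_le (x y : C) : Prop := kle F (\val x) (\val y).

Let sub_inhabited : inhabited C.
Proof. by have [w Cw] := C0; constructor; apply: (inC Cw). Qed.

Let sub_le_refl x : sub_le x x. Proof. exact: kle_refl. Qed.

Let sub_le_trans x y z : sub_le x y -> sub_le y z -> sub_le x z.
Proof. exact: kle_trans. Qed.

Let sub_le_antisym x y : sub_le x y -> sub_le y x -> x = y.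
Proof. by move=> xy yx; apply: val_inj; apply: kle_antisym xy yx. Qed.

Definition clopen_kripke_frame : kripke_frame C :=
  KripkeFrame sub_inhabited sub_le_refl sub_le_trans sub_le_antisym.

Let sub_adm : set (set C) := [set \val @^-1` U | U in adm F].

Let sub_adm_upset U : sub_adm U -> upset clopen_kripke_frame U.
Proof. by move=> [U' aU' <-] x y xy; apply: adm_upset xy. Qed.

Let sub_adm0 : sub_adm set0. Proof. by exists set0 => //; apply: adm0. Qed.
Let sub_admT : sub_adm setT. Proof. by exists setT => //; apply: admT. Qed.

Let sub_admU U V : sub_adm U -> sub_adm V -> sub_adm (U `|` V).
Proof. by move=> [U' ? <-] [V' ? <-]; exists (U' `|` V') => //; apply: admU. Qed.

Let sub_admI U V : sub_adm U -> sub_adm V -> sub_adm (U `&` V).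
Proof. by move=> [U' ? <-] [V' ? <-]; exists (U' `&` V') => //; apply: admI. Qed.

Let sub_adm_imp U V :
  sub_adm U -> sub_adm V -> sub_adm (upset_imp clopen_kripke_frame U V).
Proof.
move=> [U' aU' <-] [V' aV' <-].
(* The implication computed in [F] may be too small, since a counterexample may lie outside [C];
   only those inside [C] are excluded here. *)
exists (~` kle_preimage F (C `&` (U' `\` V'))).
  by apply/adm_setC_preimage/clopenI => //; apply: clopen_diff.
apply/seteqP; split=> x /= h; last first.
  move=> [w [Cw [Uw nVw]] xw]; apply: nVw; exact: (h (inC Cw)).
by move=> y xy Uy; apply: contrapT => nVy; apply: h; exists (\val y).
Qed.

Definition clopen_frame : general_frame C :=
  GeneralFrame sub_adm_upset sub_adm0 sub_admT sub_admU sub_admI sub_adm_imp.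

Lemma clopen_frame_descriptive : descriptive F -> descriptive clopen_frame.
Proof.
move=> [rF cF]; split=> [x y xy|X XF fipX].
  have [U [aU Ux nUy]] := rF _ _ xy.
  by exists (\val @^-1` U); split=> //; exists U.
(* The admissible sets and complements whose trace on [C] is in [X]: a point of [C] common to them
   is common to [X]. *)
pose X' := (adm F `|` [set ~` U | U in adm F]) `&`
  [set U | X (\val @^-1` U)].
have [||w [Cw wX']] := clopen_compact cF cC (X := X'); first by move=> U [].
  move=> Y fY YX'.
  have [||x xY] := fipX [set \val @^-1` U | U in Y].
  - exact: finite_image.
  - by move=> _ [U YU <-]; have [] := YX' U YU.
  - exists (\val x); split=> [|U YU]; first exact: Cval.
    by apply: (xY (\val @^-1` U)); exists U.
exists (inC Cw) => U XU.
have [[U' aU' defU]|[_ [U' aU' <-] defU]] := XF U XU; rewrite -defU /= in XU *.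
  by apply: (wX' U'); split=> //; left.
by apply: (wX' (~` U')); split=> //; right; exists U'.
Qed.

Lemma clopen_frame_subframe : descriptive F -> subframe F clopen_frame.
Proof.
move=> dF; right; split=> //; first exact: clopen_frame_descriptive.
move=> U [U' aU' defU].
(* The complement of [U] is the trace of [U'], so the image of [U] is clopen in [F]. *)
have -> : [set \val u | u in U] = C `&` ~` U'.
  apply/seteqP; split=> [_ [x Ux <-]|w [Cw nUw]].
    split=> [|U'x]; first exact: Cval.
    suff : (~` U) x by [].
    by rewrite -defU.
  exists (inC Cw) => //; apply: contrapT => nUx.
  have : (~` U) (inC Cw) by [].
  by rewrite -defU.
by apply/adm_setC_preimage/clopenI => //; apply: clopenC_adm.
Qed.

End ClopenSubframe.

(** * Finitely many witnesses *)

Lemma forces_upset W (K : kripke_frame W) V f :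
  (forall p, upset K (V p)) -> upset K (forces K V ^~ f).
Proof.
move=> uV; elim: f => [p|//|f IHf g IHg|f IHf g IHg|f _ g _] w v wv /=.
- exact: uV.
- by move=> [wf wg]; split; [apply: IHf wf|apply: IHg wg].
- by move=> [wf|wg]; [left; apply: IHf wf|right; apply: IHg wg].
- by move=> h u vu; apply/h/(kle_trans wv).
Qed.

Fixpoint subform (f : form) : set form :=
  f |` match f with
       | And g h | Or g h | Imp g h => subform g `|` subform h
       | Var _ | Bot => set0
       end.

Lemma subform_refl f : subform f f. Proof. by case: f; left. Qed.

Lemma subform_trans f g h : subform f g -> subform g h -> subform f h.
Proof.
elim: f => [p|//|f IHf f' IHf'|f IHf f' IHf'|f IHf f' IHf'] /=.
- by move=> [->//|[]].
- by move=> [->//|[]].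
all: by move=> [->//|[fg|fg] gh]; right; [left; apply: IHf|right; apply: IHf'].
Qed.

Lemma finite_subform f : finite_set (subform f).
Proof. by elim: f => *; rewrite /= !finite_setU; split. Qed.

Section Rank.
Variables (W : Type) (K : kripke_frame W) (V : nat -> set W).
Hypothesis uV : forall p, upset K (V p).

(** The number of occurrences of subformulas of [f] not forced at [w]: the measure that makes the
    search for witnesses terminate. *)
Fixpoint rank (w : W) (f : form) : nat :=
  ~~ `[< forces K V w f >] +
  match f with
  | And g h | Or g h | Imp g h => rank w g + rank w h
  | Var _ | Bot => 0
  end.

Let unforced_le w v f :
  kle K w v -> ~~ `[< forces K V v f >] <= ~~ `[< forces K V w f >].
Proof.
move=> wv; case: asboolP => // nvf; case: asboolP => // wf.
by case: nvf; apply: forces_upset wf.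
Qed.

Lemma rank_le w v f : kle K w v -> rank v f <= rank w f.
Proof.
move=> wv; have le0 g := unforced_le g wv.
elim: f => [p||f IHf g IHg|f IHf g IHg|f IHf g IHg].
- exact: leq_add (le0 (Var p)) (leqnn 0).
- exact: leq_add (le0 Bot) (leqnn 0).
- exact: leq_add (le0 (And f g)) (leq_add IHf IHg).
- exact: leq_add (le0 (Or f g)) (leq_add IHf IHg).
- exact: leq_add (le0 (Imp f g)) (leq_add IHf IHg).
Qed.

(** No summand grows along the order, and those of [g] drop from 1 to 0. *)
Lemma rank_lt w v f g : kle K w v -> subform f g ->
  forces K V v g -> ~ forces K V w g -> rank v f < rank w f.
Proof.
move=> wv fg vg nwg; have le0 h := unforced_le h wv.
have lt0 : ~~ `[< forces K V v g >] < ~~ `[< forces K V w g >].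
  by rewrite (asboolT vg) (asboolF nwg).
have leR h := rank_le h wv.
have ltD (m n p q : nat) : m <= n -> p < q -> m + p < n + q.
  by move=> mn pq; rewrite -addnS leq_add.
elim: f fg => [p||f IHf f' IHf'|f IHf f' IHf'|f IHf f' IHf'].
- by move=> [defg|[]]; rewrite defg in lt0; apply: leq_add lt0 (leqnn 0).
- by move=> [defg|[]]; rewrite defg in lt0; apply: leq_add lt0 (leqnn 0).
all: move=> [defg|[/IHf lt|/IHf' lt]].
all: try by rewrite defg in lt0; apply: leq_add lt0 (leq_add (leR f) (leR f')).
- exact: ltD (le0 (And f f')) (leq_add lt (leR f')).
- exact: ltD (le0 (And f f')) (ltD _ _ _ _ (leR f) lt).
- exact: ltD (le0 (Or f f')) (leq_add lt (leR f')).
- exact: ltD (le0 (Or f f')) (ltD _ _ _ _ (leR f) lt).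
- exact: ltD (le0 (Imp f f')) (leq_add lt (leR f')).
- exact: ltD (le0 (Imp f f')) (ltD _ _ _ _ (leR f) lt).
Qed.

(** If [a] forces [g] and refutes the implication, it is its own witness by persistence. Otherwise a
    witness newly forces [g], which lowers the rank. *)
Definition witnessed (phi : form) (A : set W) (a : W) : Prop :=
  forall g h, subform phi (Imp g h) ->
    ~ forces K V a (Imp g h) -> ~ forces K V a g ->
  exists2 b, A b &
    [/\ kle K a b, rank b phi < rank a phi, forces K V b g & ~ forces K V b h].

Lemma witnessedS phi (A B : set W) a :
  A `<=` B -> witnessed phi A a -> witnessed phi B a.
Proof.
move=> AB wA g h s n1 n2; have [b Ab hb] := wA g h s n1 n2.
by exists b => //; apply: AB.
Qed.

(** By induction on the rank of [x]: each of the finitely many subformulas contributes the finite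
    set obtained from one witness above [x]. *)
Lemma finite_witnesses phi x :
  exists A, [/\ finite_set A, A x & A `<=` witnessed phi A].
Proof.
have [n le_n] := ubnP (rank x phi); elim: n => // n IHn in x le_n *.
have /choice[A hA] (f : form) : exists A, [/\ finite_set A,
    A `<=` witnessed phi A &
    forall g h, f = Imp g h -> subform phi f ->
      ~ forces K V x (Imp g h) -> ~ forces K V x g ->
    exists2 b, A b & [/\ kle K x b, rank b phi < rank x phi,
      forces K V b g & ~ forces K V b h]].
  have [[g [h [-> sf nxf nxg]]]|nf] := pselect (exists g h,
    [/\ f = Imp g h, subform phi f, ~ forces K V x f & ~ forces K V x g]);
      last first.
    (* Default for formulas that demand no witness at [x]. *)
    exists set0; split=> // g h deff sf nxf nxg.
    by case: nf; exists g, h; subst f.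
  have [y [xy yg nyh]] : exists y, [/\ kle K x y, forces K V y g
      & ~ forces K V y h].
    apply: contrapT => ny; apply: nxf => y xy yg.
    by apply: contrapT => nyh; apply: ny; exists y.
  have sg : subform phi g.
    by apply: subform_trans sf _; right; left; apply: subform_refl.
  have lt_r := rank_lt xy sg yg nxg.
  have [|A [fA Ay wA]] := IHn y; first exact: leq_trans lt_r _.
  by exists A; split=> // g' h' [<- <-] *; exists y.
exists (x |` \bigcup_(f in subform phi) A f); split; [|by left|].
  rewrite finite_setU; split; first exact: finite_set1.
  apply: bigcup_finite; first exact: finite_subform.
  by move=> f _; have [] := hA f.
move=> a [->|[f sf Aa]].
  move=> g h s nx nxg; have [_ _ /(_ g h erefl s nx nxg)[b Ab hb]] := hA (Imp g h).
  by exists b => //; right; exists (Imp g h).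
have [_ /(_ a Aa) wa _] := hA f.
by apply: witnessedS wa => b Ab; right; exists f.
Qed.

End Rank.

(** * Cells *)

Section Cells.
Variables (W : Type) (F : general_frame W) (V : nat -> set W).
Hypothesis uV : forall p, upset F (V p).
Variables (phi : form) (A : set W).
Hypotheses (fA : finite_set A) (wA : A `<=` witnessed F V phi A).
Variable sep : W -> W -> set W.
Hypothesis sepP :
  forall a b, ~ kle F a b -> [/\ adm F (sep a b), sep a b a & ~ sep a b b].

Local Notation rk a := (rank F V a phi).

(** A recursion on [rk a], since the last clause calls only cells of smaller rank. The first two
    clauses put [w] on the same side as [a] of the separators involving [a]; the last lets [w]
    refute the implications that [a] refutes. *)
Inductive cell (a w : W) : Prop :=
| Cell of (forall d, A d -> ~ kle F a d -> sep a d w)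
    & (forall c, A c -> ~ kle F c a -> ~ sep c a w)
    & (forall b, A b -> kle F a b -> rk b < rk a ->
         exists2 v, cell b v & kle F w v).

Lemma cell_self a : A a -> cell a a.
Proof.
have [n le_n] := ubnP (rk a); elim: n => // n IHn in a le_n * => Aa.
split=> [d Ad /sepP[]//|c Ac /sepP[]//|b Ab ab lt_ba].
by exists b => //; apply: IHn => //; apply: leq_trans lt_ba _.
Qed.

(** Otherwise [sep a b] contains [w], hence [v], but the cell of [b] avoids it. *)
Lemma cell_le a b w v :
  A a -> A b -> cell a w -> cell b v -> kle F w v -> kle F a b.
Proof.
move=> Aa Ab [aw _ _] [_ bv _] wv; apply: contrapT => nab.
have [aS _ _] := sepP nab.
exact: (bv a Aa nab (adm_upset aS wv (aw b Ab nab))).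
Qed.

Lemma clopen_cell a : A a -> clopen F (cell a).
Proof.
have [n le_n] := ubnP (rk a); elim: n => // n IHn in a le_n * => Aa.
have -> : cell a =
    \bigcap_(d in A `&` [set d | ~ kle F a d]) sep a d `&`
    \bigcap_(c in A `&` [set c | ~ kle F c a]) ~` sep c a `&`
    \bigcap_(b in A `&` [set b | kle F a b /\ rk b < rk a])
      kle_preimage F (cell b).
  apply/seteqP; split=> [w [h1 h2 h3]|w [[h1 h2] h3]].
    split; [split=> d [Ad nd]; [exact: h1|exact: h2]|].
    by move=> b [Ab [ab lt_ba]]; apply: h3.
  split=> [d Ad nd|c Ac nc|b Ab ab lt_ba]; [exact: h1|exact: h2|].
  exact: h3.
apply: clopenI; first apply: clopenI.
all: apply: clopen_bigcap; first by apply: finite_setI; left.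
- by move=> d [_ /sepP[? _ _]]; apply: clopen_adm.
- by move=> c [_ /sepP[? _ _]]; apply: clopenC_adm.
- move=> b [Ab [_ lt_ba]]; apply: clopen_preimage.
  by apply: IHn => //; apply: leq_trans lt_ba _.
Qed.

Definition cells : set W := \bigcup_(a in A) cell a.

Lemma clopen_cells : clopen F cells.
Proof. by apply: clopen_bigcup => // a; apply: clopen_cell. Qed.

(** Only clopen sets may define it, so [V p] is replaced by the worlds that see no cell of a
    selected world refuting [p]. *)
Definition cell_valuation (p : nat) : set W :=
  ~` kle_preimage F (\bigcup_(a in A `&` ~` V p) cell a).

Lemma adm_cell_valuation p : adm F (cell_valuation p).
Proof.
apply/adm_setC_preimage/clopen_bigcup; first by apply: finite_setI; left.
by move=> a [Aa _]; apply: clopen_cell.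
Qed.

(** Induction on [f]. For an implication, [cell_le] carries truth from [a] to its cell, and the last
    clause of [cell] carries refutation. *)
Lemma forces_cell (K : kripke_frame cells) :
    (forall x y, kle K x y <-> kle F (\val x) (\val y)) ->
  forall f, subform phi f -> forall (x : cells) a, A a -> cell a (\val x) ->
    forces K (fun p => \val @^-1` cell_valuation p) x f <-> forces F V a f.
Proof.
move=> KF; elim=> [p||g IHg h IHh|g IHg h IHh|g IHg h IHh] sf x a Aa ax //=.
- split=> [nx|Va [w [b [Ab nVb] bw] xw]].
    apply: contrapT => nVa; apply: nx; exists (\val x); last exact: kle_refl.
    by exists a.
  by apply: nVb; apply: (uV _ Va); apply: (cell_le Aa Ab ax bw).
all: have sg : subform phi g by
  apply: subform_trans sf _; right; left; apply: subform_refl.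
all: have sh : subform phi h by
  apply: subform_trans sf _; right; right; apply: subform_refl.
- by rewrite (IHg sg x a)// (IHh sh x a).
- by rewrite (IHg sg x a)// (IHh sh x a).
split=> [xgh|agh y xy yg]; last first.
  have [b Ab bv] := set_valP y.
  apply/(IHh sh y b Ab bv)/agh; last exact/(IHg sg y b Ab bv).
  by apply: cell_le ax bv _ => //; apply/KF.
apply: contrapT => nagh.
(* Here [a] is its own witness: [x] forces [g], hence [h], so [a] forces [h]. In the other case a
   selected witness of smaller rank exists, and [x] sees its cell. *)
have [ag|nag] := pselect (forces F V a g).
  apply: nagh => b ab _; apply: (forces_upset uV ab).
  apply/(IHh sh x a Aa ax)/xgh; first by apply/KF/kle_refl.
  exact/(IHg sg x a Aa ax).
have [b Ab [ab lt_ba bg nbh]] := wA Aa sf nagh nag.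
have [_ _ /(_ b Ab ab lt_ba)[v bv xv]] := ax.
have Cv : cells v by exists b.
pose y : cells := exist _ v (mem_set Cv).
apply: nbh; apply/(IHh sh y b Ab bv)/xgh; first exact/KF.
exact/(IHg sg y b Ab bv).
Qed.

End Cells.

Lemma subframe_logic_kripke_persistent (L : set form) W (F : general_frame W) :
    subframe_logic L -> L_frame L F -> descriptive F ->
  L_frame L (general_of_kripke F).
Proof.
move=> [_ sL] LF dF; split; first by left.
move=> phi Lphi V uV x; apply: contrapT => nx.
have [A [fA Ax wA]] := finite_witnesses uV phi x.
(* Refinedness supplies the separators; related pairs get the dummy value [setT]. *)
have /choice[sep' sepP'] (ab : W * W) : exists U, ~ kle F ab.1 ab.2 ->
    [/\ adm F U, U ab.1 & ~ U ab.2].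
  have [le|/dF.1[U hU]] := pselect (kle F ab.1 ab.2); first by exists setT.
  by exists U.
pose sep a b := sep' (a, b).
have sepP a b : ~ kle F a b -> [/\ adm F (sep a b), sep a b a & ~ sep a b b].
  exact: (sepP' (a, b)).
have cx : cell F V phi A sep x x by apply: cell_self.
have Cx : cells F V phi A sep x by exists x.
have cC := clopen_cells V phi fA sepP.
have C0 : cells F V phi A sep !=set0 by exists x.
pose G := clopen_frame cC C0.
have [_ /(_ phi Lphi) vG] := sL _ _ _ _ LF (clopen_frame_subframe cC C0 dF).
apply: nx.
apply/(forces_cell uV wA sepP (K := G) _ (subform_refl phi)
  (x := exist _ x (mem_set Cx)) Ax cx) => //.
by apply: vG => p; exists (cell_valuation F V phi A sep p) => //;
  apply: adm_cell_valuation.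
Qed.

(** * The canonical descriptive frame *)

Section Canonical.
Variable L : set form.
Hypothesis logicL : intermediate_logic L.

Let IPCL : IPC `<=` L. Proof. by have [] := logicL. Qed.

Inductive ded (X : set form) : set form :=
| ded_ax f of L f : ded X f
| ded_hyp f of X f : ded X f
| ded_mp f g of ded X (Imp f g) & ded X f : ded X g.

Let ded_IPC X f : IPC f -> ded X f.
Proof. by move=> /IPCL; apply: ded_ax. Qed.

Lemma dedS X Y : X `<=` Y -> ded X `<=` ded Y.
Proof.
move=> XY f; elim=> {}f => [Lf|/XY Yf|g _ + _]; [exact: ded_ax|exact: ded_hyp|].
exact: ded_mp.
Qed.

Lemma ded_imp X f g : ded (f |` X) g -> ded X (Imp f g).
Proof.
have K h : ded X h -> ded X (Imp f h).
  by apply: ded_mp; apply/ded_IPC/IPC_K.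
elim=> {}g => [Lg|[->|Xg]|h _ IH1 _ IH2].
- exact/K/ded_ax.
- have S := IPC_S f (Imp f f) f.
  apply/ded_IPC/IPC_MP; last exact: (IPC_K f f).
  exact: IPC_MP S (IPC_K _ _).
- exact/K/ded_hyp.
- by apply: ded_mp IH2; apply: ded_mp IH1; apply/ded_IPC/IPC_S.
Qed.

Lemma ded_or X f g h :
  ded X (Imp f h) -> ded X (Imp g h) -> ded X (Imp (Or f g) h).
Proof.
by move=> dfh; apply: ded_mp; apply: ded_mp dfh; apply/ded_IPC/IPC_orE.
Qed.

(** A derivation uses finitely many hypotheses, so one member of the chain suffices; the first
    alternative covers the empty chain. *)
Lemma ded_chain X (C : set (set form)) f : total_on C subset ->
  ded (X `|` \bigcup_(Y in C) Y) f ->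
  ded X f \/ exists2 Y, C Y & ded (X `|` Y) f.
Proof.
move=> totC; elim=> {}f => [Lf|[Xf|[Y CY Yf]]|g _ IH1 _ IH2].
- by left; apply: ded_ax.
- by left; apply: ded_hyp.
- by right; exists Y => //; apply: ded_hyp; right.
case: IH1 IH2 => [d1|[Y1 C1 d1]] [d2|[Y2 C2 d2]].
- by left; apply: ded_mp d1 d2.
- by right; exists Y2 => //; apply: ded_mp d2; apply: dedS d1; left.
- by right; exists Y1 => //; apply: ded_mp d1 _; apply: dedS d2; left.
- have [Y12|Y21] := totC _ _ C1 C2; right; [exists Y2|exists Y1] => //.
  + by apply: ded_mp d2; apply: dedS d1; apply: setUS.
  + by apply: ded_mp d1 _; apply: dedS d2; apply: setUS.
Qed.

(** Lindenbaum lemma in the style of the prime filter theorem: a maximal extension of [X] that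
    derives nothing in [J] is prime, as [J] is closed under disjunction. *)
Lemma prime_extension (X J : set form) :
    J Bot -> (forall f g, J f -> J g -> J (Or f g)) ->
    (forall f, ded X f -> ~ J f) ->
  exists G : canonical_worlds L, X `<=` \val G /\ forall f, J f -> ~ (\val G) f.
Proof.
move=> JBot JOr XJ.
pose P Y := forall f, ded (X `|` Y) f -> ~ J f.
have [|Y [PY maxY]] := @Zorn_bigcup _ P.
  move=> C CP totC f /(ded_chain totC)[/XJ//|[Y /CP]]; exact.
pose G := ded (X `|` Y).
(* By maximality, adding a missing [f] derives some member of [J]. *)
have extG f : ~ G f -> exists2 j, J j & G (Imp f j).
  move=> nGf.
  have /maxY : Y `<` f |` Y.
    split; first by move=> h; right.
    by move=> fY; apply: nGf; apply: ded_hyp; right; apply: fY; left.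
  move=> /existsNP[j /not_implyP[dj /contrapT Jj]]; exists j => //.
  by apply: ded_imp; apply: dedS dj; rewrite setUCA.
have cG : canonical_worlds L G.
  split=> [||f g Gfg]; first by split; [exact: ded_ax|exact: ded_mp].
    by move=> /PY.
  apply: contrapT => /not_orP[/extG[j Jj Gj] /extG[k Jk Gk]].
  (* If both disjuncts are missing, [Or f g] yields [Or j k], which lies in [J]. *)
  apply: (PY (Or j k)); last exact: JOr.
  have toOr h l m : G (Imp h l) -> IPC (Imp l m) -> G (Imp h m).
    move=> Ghl lm; apply: ded_imp; apply: ded_mp (ded_IPC _ lm) _.
    apply: (@ded_mp _ h); last by apply: ded_hyp; left.
    by apply: dedS Ghl; right.
  apply: ded_mp Gfg; apply: ded_or.
    exact: toOr Gj (IPC_orIl _ _).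
  exact: toOr Gk (IPC_orIr _ _).
exists (exist _ G (mem_set cG)); split=> [f Xf|f Jf /PY//].
by apply: ded_hyp; left.
Qed.

Lemma canonical_avoiding X f : ~ ded X f ->
  exists G : canonical_worlds L, X `<=` \val G /\ ~ (\val G) f.
Proof.
move=> nf; have [|g h|g dg gf|G [XG Gf]] := @prime_extension X
    [set g | ded X (Imp g f)].
- exact/ded_IPC/IPC_botE.
- exact: ded_or.
- by apply: nf; apply: ded_mp gf dg.
exists G; split=> //; apply: Gf; apply: ded_imp.
by apply: ded_hyp; left.
Qed.

Section Worlds.
Variable G : canonical_worlds L.

Lemma world_ded f : ded (\val G) f -> (\val G) f.
Proof.
have [[LG mpG] _ _] := set_valP G.
by elim=> {}f => [/LG//|//|g _ + _]; apply: mpG.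
Qed.

Lemma world_bot : ~ (\val G) Bot.
Proof. by have [] := set_valP G. Qed.

Lemma world_and f g : (\val G) (And f g) <-> (\val G) f /\ (\val G) g.
Proof.
split=> [Gfg|[Gf Gg]].
  split; apply: world_ded; apply: (ded_mp _ (ded_hyp Gfg)); apply: ded_IPC.
    exact: IPC_andEl.
  exact: IPC_andEr.
apply: world_ded; apply: (ded_mp _ (ded_hyp Gg)).
by apply: (ded_mp _ (ded_hyp Gf)); apply/ded_IPC/IPC_andI.
Qed.

Lemma world_or f g : (\val G) (Or f g) <-> (\val G) f \/ (\val G) g.
Proof.
split=> [|[Gf|Gg]]; first by have [_ _] := set_valP G; apply.
  by apply/world_ded/(ded_mp _ (ded_hyp Gf))/ded_IPC/IPC_orIl.
by apply/world_ded/(ded_mp _ (ded_hyp Gg))/ded_IPC/IPC_orIr.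
Qed.

Lemma world_imp f g : (\val G) (Imp f g) <->
  forall H : canonical_worlds L, \val G `<=` \val H ->
    (\val H) f -> (\val H) g.
Proof.
split=> [Gfg H /(_ _ Gfg) Hfg Hf|h].
  by have [[_ mpH] _ _] := set_valP H; apply: mpH Hf.
apply: contrapT => nGfg.
have [d|H [GH nHg]] := @canonical_avoiding (f |` \val G) g.
  exact/nGfg/world_ded/ded_imp.
by apply/nHg/h => [k Gk|]; apply: GH; [right|left].
Qed.

End Worlds.

Hypothesis consL : ~ L Bot.

Lemma canonical_inhabited : inhabited (canonical_worlds L).
Proof.
have dedL f : ded set0 f -> L f.
  by have [_ mpL _] := logicL; elim=> {}f // g _ + _; apply: mpL.
have [/dedL//|G _] := @canonical_avoiding set0 Bot.
by constructor.
Qed.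

Local Notation K := (canonical_kripke_frame canonical_inhabited).

Definition containing (f : form) : set (canonical_worlds L) :=
  [set G | (\val G) f].

Let cadm : set (set (canonical_worlds L)) := range containing.

Let cadm_upset U : cadm U -> upset K U.
Proof. by move=> [f _ <-] G H; apply. Qed.

Let cadm0 : cadm set0.
Proof. by exists Bot => //; apply/seteqP; split=> // G /world_bot. Qed.

Let cadmT : cadm setT.
Proof.
exists (Imp Bot Bot) => //; apply/seteqP; split=> // G _.
exact/world_ded/ded_IPC/IPC_botE.
Qed.

Let cadmU U V : cadm U -> cadm V -> cadm (U `|` V).
Proof.
move=> [f _ <-] [g _ <-]; exists (Or f g) => //.
by apply/seteqP; split=> G /world_or.
Qed.

Let cadmI U V : cadm U -> cadm V -> cadm (U `&` V).
Proof.
move=> [f _ <-] [g _ <-]; exists (And f g) => //.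
by apply/seteqP; split=> G /world_and.
Qed.

Let cadm_imp U V : cadm U -> cadm V -> cadm (upset_imp K U V).
Proof.
move=> [f _ <-] [g _ <-]; exists (Imp f g) => //.
by apply/seteqP; split=> G /world_imp.
Qed.

Definition canonical_frame : general_frame (canonical_worlds L) :=
  GeneralFrame cadm_upset cadm0 cadmT cadmU cadmI cadm_imp.

Lemma canonical_frame_refined : refined canonical_frame.
Proof.
move=> G H /existsNP[f /not_implyP[Gf nHf]].
by exists (containing f); split=> //; exists f.
Qed.

(** Finite disjunctions, the form of [J] that [prime_extension] accepts. *)
Inductive or_closure (D : set form) : set form :=
| or_closure_bot : or_closure D Bot
| or_closure_mem f of D f : or_closure D f
| or_closure_or f g of or_closure D f & or_closure D g : or_closure D (Or f g).

(** A common point is a prime theory containing [P] and avoiding [N]. Deriving a formula from [P],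
    or placing it in [N], uses finitely many members of [X], so the finite intersection property
    keeps the two apart. *)
Lemma canonical_frame_compact : compact_frame canonical_frame.
Proof.
move=> X XF fipX.
pose P := [set f | X (containing f)].
pose N := or_closure [set f | X (~` containing f)].
have finP f : ded P f -> exists Y, [/\ finite_set Y, Y `<=` X
    & \bigcap_(U in Y) U `<=` containing f].
  elim=> {}f => [Lf|Pf|g _ [Y1 [fY1 XY1 Y1f]] _ [Y2 [fY2 XY2 Y2f]]].
  - exists set0; split=> // G _.
    exact/world_ded/ded_ax.
  - exists [set containing f]; split=> [|_ ->//|G]; first exact: finite_set1.
    exact.
  - exists (Y1 `|` Y2); split; [by rewrite finite_setU|by rewrite subUset|].
    rewrite bigcap_setU => G [/Y1f Ggf /Y2f Gg].
    exact/world_ded/(ded_mp (ded_hyp Ggf))/ded_hyp.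
have finN f : N f -> exists Y, [/\ finite_set Y, Y `<=` X
    & \bigcap_(U in Y) U `<=` ~` containing f].
  elim=> {f} [|f Nf|f g _ [Y1 [fY1 XY1 Y1f]] _ [Y2 [fY2 XY2 Y2f]]].
  - by exists set0; split=> // G _; apply: world_bot.
  - exists [set ~` containing f]; split=> [|_ ->//|G]; first exact: finite_set1.
    exact.
  - exists (Y1 `|` Y2); split; [by rewrite finite_setU|by rewrite subUset|].
    by rewrite bigcap_setU => G [/Y1f nGf /Y2f nGg] /world_or[].
have [||f|G [PG NG]] := @prime_extension P N.
- exact: or_closure_bot.
- exact: or_closure_or.
- move=> /finP[Y1 [fY1 XY1 Y1f]] /finN[Y2 [fY2 XY2 Y2f]].
  have [||G] := fipX (Y1 `|` Y2); [by rewrite finite_setU|by rewrite subUset|].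
  by rewrite bigcap_setU => -[/Y1f Gf /Y2f].
exists G => U XU.
have [[f _ defU]|[_ [f _ <-] defU]] := XF U XU; rewrite -defU in XU *.
  exact: PG.
by apply: NG; apply: or_closure_mem.
Qed.

Lemma canonical_frame_valid f : L f -> valid canonical_frame f.
Proof.
move=> Lf V aV G.
(* An admissible valuation amounts to a substitution [s]; truth of [f] becomes membership of
   [fsubst s f], and [L] is closed under substitution. *)
have /choice[s sV] p : exists g, V p = containing g.
  by have [g _ <-] := aV p; exists g.
suff truth g : forall H, forces canonical_frame V H g <-> (\val H) (fsubst s g).
  by apply/truth/world_ded/ded_ax; have [_ _] := logicL; apply.
elim: g => [p||g IHg h IHh|g IHg h IHh|g IHg h IHh] H /=.
- by rewrite sV.
- by split=> // /world_bot.
- by rewrite IHg IHh world_and.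
- by rewrite IHg IHh world_or.
- rewrite world_imp; split=> hH H' HH' H'g.
    exact/IHh/hH/IHg.
  exact/IHh/hH/IHg.
Qed.

End Canonical.

Theorem corollary4p13 (L : set form) (hL : subframe_logic L) :
  (forall (W : Type) (F : general_frame W) (A : set W) (G : general_frame A),
     L_frame L F -> substructure F G -> L_frame L G)
  /\ canonical_logic L.
Proof.
split=> [W F A G LF [kdF kdG FG]|consL].
  (* With all upsets admissible on both sides, a substructure is a Kripke subframe; validity then
     passes to the smaller family [adm G]. *)
  have LK : L_frame L (general_of_kripke F).
    case: kdF => [kF|dF]; last exact: subframe_logic_kripke_persistent.
    by split=> [|f Lf V aV]; [left|apply: LF.2 => // p; apply/kF/aV].
  have [] : L_frame L (general_of_kripke G).
    by apply: hL.2 LK _; left; split.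
  move=> _ vG; split=> // f Lf V aV; apply: vG => // p.
  by move=> w v; apply: adm_upset.
have logicL := hL.1.
exists (canonical_inhabited logicL consL).
apply: (@subframe_logic_kripke_persistent _ _ (canonical_frame logicL consL)) => //.
  split; last exact: canonical_frame_valid.
  right; split; first exact: canonical_frame_refined.
  exact: canonical_frame_compact.
split; first exact: canonical_frame_refined.
exact: canonical_frame_compact.
Qed.
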